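(* Let $\gamma\ge 3$, $\kappa>\gamma$, $m\ge 1$, $M\ge 2$ be integers, and let $p_0^*,\dots,p_m^*\ge 0$ be fixed real numbers with $\sum_{i=0}^m p_i^*=1$. For a real matrix $\mathbf{P}=[p_{i,j}]_{0\le i\le m,\,0\le j\le M-1}$, with $\mathbf{p}^{\mathrm{con}}$ the vector obtained by concatenating its rows, let $f(X,Y)=\sum_{i=0}^m\sum_{j=0}^{M-1}p_{i,j}X^iY^j$ and $$\begin{aligned}N_8(\mathbf{p}^{\mathrm{con}})=\sum_{M\mid b}\Big\{& w_1\left[f^2(X^2,Y^2)f^2(X^{-2},Y^{-2})\right]_{0,b}\\ &+w_2\left[f(X^2,Y^2)f(X^{-2},Y^{-2})f^2(X,Y)f^2(X^{-1},Y^{-1})\right]_{0,b}\\ &+w_3\left[f(X^2,Y^2)f^2(X,Y)f^4(X^{-1},Y^{-1})\right]_{0,b}\\ &+w_4\left[f^4(X,Y)f^4(X^{-1},Y^{-1})\right]_{0,b}\Big\},\end{aligned}$$ where $w_1=\binom{\gamma}{2}\binom{\kappa}{2}$, $w_2=3\binom{\gamma}{2}\binom{\kappa}{3}+3\binom{\gamma}{3}\binom{\kappa}{2}$, $w_3=18\binom{\gamma}{3}\binom{\kappa}{3}$, and $w_4=6\binom{\gamma}{2}\binom{\kappa}{4}+6\binom{\gamma}{4}\binom{\kappa}{2}+36\binom{\gamma}{3}\binom{\kappa}{4}+36\binom{\gamma}{4}\binom{\kappa}{3}+72\binom{\gamma}{4}\binom{\kappa}{4}$ if $\gamma\ge 4$,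 $w_4=6\binom{\gamma}{2}\binom{\kappa}{4}+36\binom{\gamma}{3}\binom{\kappa}{4}$ if $\gamma=3$. For $N_8(\mathbf{p}^{\mathrm{con}})$ to be locally minimized subject to the constraints $$p_{i,0}+p_{i,1}+\dots+p_{i,M-1}=p_i^*\quad\text{for all } i\in\{0,1,\dots,m\},$$ where each $p_{i,j}\in[0,1]$, it is necessary that there exist $c_0,\dots,c_m\in\mathbb{R}$ such that $$\begin{aligned}\sum_{M\mid b}\Big\{& w_1\left[4f^2(X^2,Y^2)f(X^{-2},Y^{-2})\right]_{2i,b+2j}\\ &+w_2\left[2f(X^2,Y^2)f^2(X,Y)f^2(X^{-1},Y^{-1})\right]_{2i,b+2j}\\ &+w_2\left[4f(X^2,Y^2)f(X^{-2},Y^{-2})f^2(X,Y)f(X^{-1},Y^{-1})\right]_{i,b+j}\\ &+w_3\left[f^2(X,Y)f^4(X^{-1},Y^{-1})\right]_{-2i,b-2j}\\ &+w_3\left[2f(X^2,Y^2)f(X,Y)f^4(X^{-1},Y^{-1})\right]_{-i,b-j}\\ &+w_3\left[4f(X^2,Y^2)f^2(X,Y)f^3(X^{-1},Y^{-1})\right]_{i,b+j}\\ &+w_4\left[8f^4(X,Y)f^3(X^{-1},Y^{-1})\right]_{i,b+j}\Big\}=c_i\end{aligned}$$ for all $i\in\{0,1,\dots,m\}$ and $j\in\{0,1,\dots,M-1\}$.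
   Context: $[\cdot]_{i,j}$ denotes the coefficient of $X^iY^j$ in a two-variable Laurent polynomial; $\sum_{M\mid b}$ is the sum over all integers $b$ (positive, negative or zero) divisible by $M$; $f^k(X,Y)$ means $(f(X,Y))^k$ and $f^k(X^a,Y^a)$ means $(f(X^a,Y^a))^k$. The constant $c_i$ may depend on $i$ but not on $j$. *)

(* Defs.v *)
From HB Require Import structures.
From mathcomp Require Import all_boot all_order all_algebra finmap.
From mathcomp Require Import all_classical reals topology.
From mathcomp Require Import monalg.

Set Implicit Arguments.
Unset Strict Implicit.
Unset Printing Implicit Defensive.

Import Order.TTheory GRing.Theory Num.Theory.

Local Open Scope fset_scope.
Local Open Scope ring_scope.

(* Laurent polynomials in X and Y: finitely supported families of coefficients
   indexed by the exponents (i, j) of X^i Y^j. The ring structure that monalg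
   puts on {malg R[K]} is unavailable for K = int * int, since a monomType has
   no invertible monomial other than 1; only its module structure is reused. *)
Definition laurent (R : comNzRingType) : Type := {malg R[(int * int)%type]}.

Section LaurentRing.
Variable R : comNzRingType.
Notation L := (laurent R).
Implicit Types (g : L) (k : int * int).

HB.instance Definition _ := GRing.Lmodule.copy L {malg R[(int * int)%type]}.

Definition laurent_one : L := << 1 *g (0 : int * int) >>.

Definition laurent_mul g1 g2 : L :=
  \sum_(k1 <- msupp g1) \sum_(k2 <- msupp g2)
    (<< mcoeff k1 g1 * mcoeff k2 g2 *g k1 + k2 >> : L).

Lemma laurent_mulw (d1 d2 : {fset int * int}) g1 g2 :
  msupp g1 `<=` d1 -> msupp g2 `<=` d2 ->
  laurent_mul g1 g2 = \sum_(k1 <- d1) \sum_(k2 <- d2)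
    (<< mcoeff k1 g1 * mcoeff k2 g2 *g k1 + k2 >> : L).
Proof.
move=> le1 le2; rewrite /laurent_mul (big_fset_incl _ le1) /=.
  apply: eq_bigr => k1 _; apply: big_fset_incl => // k _ /mcoeff_outdom ->.
  by rewrite mulr0 monalgU0.
move=> k _ /mcoeff_outdom g1k.
by rewrite big1 // => k' _; rewrite g1k mul0r monalgU0.
Qed.

Lemma laurent_mulC : commutative laurent_mul.
Proof.
move=> g1 g2; rewrite /laurent_mul exchange_big /=.
by do 2![apply: eq_bigr => ? _]; rewrite mulrC addrC.
Qed.

Lemma laurent_mul0 : left_zero 0 laurent_mul.
Proof. by move=> g; rewrite /laurent_mul msupp0 big_seq_fset0. Qed.

Lemma laurent_mulDl : left_distributive laurent_mul +%R.
Proof.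
move=> g1 g2 g; pose d := msupp g1 `|` msupp g2.
rewrite (@laurent_mulw d (msupp g) (g1 + g2)) ?msuppD_le //.
rewrite (@laurent_mulw d (msupp g) g1) ?fsubsetUl //.
rewrite (@laurent_mulw d (msupp g) g2) ?fsubsetUr //.
rewrite -big_split; apply: eq_bigr => k1 _.
rewrite -big_split; apply: eq_bigr => k2 _.
by rewrite mcoeffD mulrDl monalgUD.
Qed.

Lemma laurent_mulDr : right_distributive laurent_mul +%R.
Proof. by move=> g g1 g2; rewrite ![laurent_mul g _]laurent_mulC laurent_mulDl. Qed.

Lemma laurent_mulUU (c1 c2 : R) k1 k2 :
  laurent_mul << c1 *g k1 >> << c2 *g k2 >> = << c1 * c2 *g k1 + k2 >>.
Proof.
by rewrite (laurent_mulw msuppU_le msuppU_le) !big_seq_fset1 !mcoeffUU.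
Qed.

Lemma laurent_mulEl g1 g2 :
  laurent_mul g1 g2 =
  \sum_(k1 <- msupp g1) laurent_mul << mcoeff k1 g1 *g k1 >> g2.
Proof.
apply: eq_bigr => k _.
by rewrite (laurent_mulw msuppU_le (fsubset_refl _)) big_seq_fset1 mcoeffUU.
Qed.

Lemma laurent_mulEr g1 g2 :
  laurent_mul g1 g2 =
  \sum_(k2 <- msupp g2) laurent_mul g1 << mcoeff k2 g2 *g k2 >>.
Proof.
by rewrite laurent_mulC laurent_mulEl; apply: eq_bigr => k _; rewrite laurent_mulC.
Qed.

Lemma laurent_mul1 : left_id laurent_one laurent_mul.
Proof.
move=> g; rewrite laurent_mulEr [RHS]monalgE.
by apply: eq_bigr => k _; rewrite laurent_mulUU mul1r add0r.
Qed.

Lemma laurent_mulA : associative laurent_mul.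
Proof.
have mul0 : right_zero 0 laurent_mul by move=> g; rewrite laurent_mulC laurent_mul0.
move=> g1 g2 g3.
rewrite [laurent_mul g1 g2]laurent_mulEl.
rewrite [RHS](big_morph (laurent_mul^~ _)
  (fun _ _ => laurent_mulDl _ _ _) (laurent_mul0 _)).
rewrite laurent_mulEl; apply: eq_bigr => k1 _.
rewrite [laurent_mul g2 g3]laurent_mulEl [laurent_mul _ g2]laurent_mulEr.
rewrite [LHS](big_morph (laurent_mul _)
  (fun _ _ => laurent_mulDr _ _ _) (mul0 _)).
rewrite [RHS](big_morph (laurent_mul^~ _)
  (fun _ _ => laurent_mulDl _ _ _) (laurent_mul0 _)).
apply: eq_bigr => k2 _.
rewrite [X in laurent_mul _ X]laurent_mulEr [RHS]laurent_mulEr.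
rewrite [LHS](big_morph (laurent_mul _)
  (fun _ _ => laurent_mulDr _ _ _) (mul0 _)).
by apply: eq_bigr => k3 _; rewrite !laurent_mulUU mulrA addrA.
Qed.

Lemma laurent_one_neq0 : laurent_one != 0.
Proof.
apply/eqP => /(congr1 (mcoeff (0 : int * int))) /eqP.
by rewrite mcoeffUU mcoeff0 oner_eq0.
Qed.

HB.instance Definition _ := GRing.Zmodule_isComNzRing.Build L
  laurent_mulA laurent_mulC laurent_mul1 laurent_mulDl laurent_one_neq0.

End LaurentRing.

(* The coefficient of X^i Y^j in g. *)
Definition lcoef (R : comNzRingType) (g : laurent R) (i j : int) : R :=
  mcoeff (i, j) g.

(* g(X^a, Y^a). *)
Definition ldilate (R : comNzRingType) (a : int) (g : laurent R) : laurent R :=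
  \sum_(k <- msupp g) (<< mcoeff k g *g (a * k.1, a * k.2) >> : laurent R).

Definition lpoly (R : comNzRingType) (m M : nat) (P : 'M[R]_(m, M)) :
    laurent R :=
  \sum_(i < m) \sum_(j < M) (<< P i j *g (i%:Z, j%:Z) >> : laurent R).

Definition w1 (gamma kappa : nat) : nat := ('C(gamma, 2) * 'C(kappa, 2))%N.

Definition w2 (gamma kappa : nat) : nat :=
  (3 * 'C(gamma, 2) * 'C(kappa, 3) + 3 * 'C(gamma, 3) * 'C(kappa, 2))%N.

Definition w3 (gamma kappa : nat) : nat :=
  (18 * 'C(gamma, 3) * 'C(kappa, 3))%N.

Definition w4 (gamma kappa : nat) : nat :=
  (if 4 <= gamma then
     6 * 'C(gamma, 2) * 'C(kappa, 4) + 6 * 'C(gamma, 4) * 'C(kappa, 2)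
     + 36 * 'C(gamma, 3) * 'C(kappa, 4) + 36 * 'C(gamma, 4) * 'C(kappa, 3)
     + 72 * 'C(gamma, 4) * 'C(kappa, 4)
   else
     6 * 'C(gamma, 2) * 'C(kappa, 4) + 36 * 'C(gamma, 3) * 'C(kappa, 4))%N.

(* The set of (positive, negative or zero) multiples of M; a sum
   \sum_(b \in multiples M) is a finite sum whenever the summand is finitely
   supported, as is the case for coefficients of a Laurent polynomial. *)
Definition multiples (M : nat) : set int := [set b : int | (M%:Z %| b)%Z].

(* The concatenation of the rows of P is identified with the matrix P. *)
Definition N8 (R : realType) (gamma kappa m M : nat) (P : 'M[R]_(m.+1, M)) : R :=
  let f := lpoly P in
  \sum_(b \in multiples M)
    ((w1 gamma kappa)%:R * lcoef (ldilate 2 f ^+ 2 * ldilate (-2) f ^+ 2) 0 b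
   + (w2 gamma kappa)%:R
       * lcoef (ldilate 2 f * ldilate (-2) f * f ^+ 2 * ldilate (-1) f ^+ 2) 0 b
   + (w3 gamma kappa)%:R
       * lcoef (ldilate 2 f * f ^+ 2 * ldilate (-1) f ^+ 4) 0 b
   + (w4 gamma kappa)%:R * lcoef (f ^+ 4 * ldilate (-1) f ^+ 4) 0 b).

Definition feasible (R : realType) (m M : nat) (pstar : 'I_m.+1 -> R) :
    set 'M[R]_(m.+1, M) :=
  [set P | (forall i j, 0 <= P i j <= 1) /\
           (forall i, \sum_(j < M) P i j = pstar i)].

(* x minimizes F over the points of A lying in some neighbourhood of x. *)
Definition local_min_on (R : realType) (T : topologicalType) (A : set T)
    (F : T -> R) (x : T) : Prop :=
  A x /\ \forall y \near x, A y -> F x <= F y.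

(* Main.v *)
(* Evaluate f at roots of unity Y = w with w^M = 1: N_8 is the average over X
   and w of
     w1 |a|^4 + w2 |a|^2 |b|^4 + w3 Re (a b^2 conj(b)^4) + w4 |b|^8
   with a = f(X^2, w^2) and b = f(X, w). The constraints fix f(X, 1) and leave
   the values at w <> 1 free. Moving P towards the matrix U whose rows are
   constant multiplies the latter by some s < 1, and since
   9 w3^2 <= 16 w2 w4 this strictly decreases N_8, unless these values already
   vanish. Hence a local minimizer, even on the boundary of the constraint
   set, equals U, and at U every polynomial of the gradient is invariant under
   multiplication by Y, or by Y^2 when it is read at an exponent b + 2j.

   Instead of evaluating, we compute in R[X^{+-1}, Y] / (Y^M - 1), where the
   conditions Y = 1 and Y^2 = 1 become idempotents, and where the average
   becomes the coefficient of X^0 Y^0, a positive functional by Parseval. *)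

Require Import Defs.
From HB Require Import structures.
From mathcomp Require Import all_boot all_order all_algebra finmap.
From mathcomp Require Import all_classical reals topology.
From mathcomp Require Import monalg ring_quotient generic_quotient.
From mathcomp Require Import ring lra.

Set Implicit Arguments.
Unset Strict Implicit.
Unset Printing Implicit Defensive.

Import Order.TTheory GRing.Theory Num.Theory.
Import numFieldTopology.Exports.

Local Open Scope ring_scope.

(** * The inequality between the weights *)

Lemma binS_field (R : realFieldType) n k :
  (k <= n)%N -> 'C(n, k.+1)%:R = 'C(n, k)%:R * (n%:R - k%:R) / k.+1%:R :> R.
Proof.
move=> kn; have k0 : k.+1%:R != 0 :> R by rewrite pnatr_eq0.
apply: (mulIf k0); rewrite mulfVK // -natrB // -!natrM.
by rewrite mulnC mul_bin_left mulnC.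
Qed.

(** With [x = gamma - 2] and [y = kappa - 2], each weight is [G * K] times a polynomial in [x] and
    [y], so a polynomial inequality remains. It is an equality at [gamma = 3], [kappa = 4]. *)
Lemma weights_le (R : realFieldType) gamma kappa :
  (3 <= gamma)%N -> (gamma < kappa)%N ->
  9 * (w3 gamma kappa)%:R ^+ 2 <=
  16 * (w2 gamma kappa)%:R * (w4 gamma kappa)%:R :> R.
Proof.
move=> hg hk.
have kappa_ge4 : (4 <= kappa)%N by exact: leq_ltn_trans hg hk.
pose x : R := gamma%:R - 2; pose y : R := kappa%:R - 2.
pose G : R := 'C(gamma, 2)%:R; pose K : R := 'C(kappa, 2)%:R.
have G3 : 'C(gamma, 3)%:R = G * x / 3 :> R by rewrite binS_field // ltnW.
have K3 : 'C(kappa, 3)%:R = K * y / 3 :> R.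
  by rewrite binS_field // ltnW // ltnW.
have G4 : 'C(gamma, 4)%:R = G * x * (x - 1) / 12 :> R.
  by rewrite binS_field // G3 /x; field.
have K4 : 'C(kappa, 4)%:R = K * y * (y - 1) / 12 :> R.
  by rewrite binS_field ?(ltnW kappa_ge4) // K3 /y; field.
have w3E : (w3 gamma kappa)%:R = 2 * (G * K) * (x * y) :> R.
  by rewrite /w3 !natrM G3 K3; field.
have w2E : (w2 gamma kappa)%:R = G * K * (x + y) :> R.
  by rewrite /w2 natrD !natrM G3 K3 -/G -/K; field.
pose q := (y * (y - 1) + x * (x - 1)) / 2 + x * y * (x + y - 2)
  + x * y * (x - 1) * (y - 1) / 2.
have ler_natW n k : (k <= n)%N -> k%:R <= n%:R :> R by rewrite ler_nat.
have x_ge1 : 1 <= x by move: (ler_natW _ _ hg); rewrite /x; lra.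
have y_ge2 : 2 <= y by move: (ler_natW _ _ kappa_ge4); rewrite /y; lra.
(* Both branches of w4 give the same formula, as C(3, 4) = 0. *)
have [w4E x_cases] : (w4 gamma kappa)%:R = G * K * q :> R /\
    (x = 1 \/ 2 <= x /\ 3 <= y).
  rewrite /w4; case: ifP => [g4|/negbT].
    split; last first.
      right; move: (ler_natW _ _ g4) (ler_natW _ _ (leq_ltn_trans g4 hk)); rewrite /x /y.
      by split; lra.
    by rewrite !natrD !natrM G3 K3 G4 K4 -/G -/K /q; field.
  rewrite -ltnNge ltnS => g3; have x1 : x = 1.
    by move: (ler_natW _ _ g3) x_ge1; rewrite /x; lra.
  split; last by left.
  by rewrite !natrD !natrM G3 K4 -/G -/K /q x1; field.
rewrite w3E w2E w4E.
have GK2_ge0 : 0 <= (G * K) ^+ 2 by exact: sqr_ge0.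
suff h : 9 * (2 * (x * y)) ^+ 2 <= 16 * (x + y) * q.
  by have := ler_wpM2l GK2_ge0 h; lra.
case: x_cases => [x1|[x_ge2 y_ler_natW]].
  rewrite /q x1; have : 0 <= 12 * y * ((2 * y + 1) * (y - 2)).
    by rewrite !mulr_ge0 //; lra.
  lra.
have xy_ge0 : 0 <= x * y by rewrite mulr_ge0 //; lra.
have x2_ge0 : 0 <= x * (x - 1) by rewrite mulr_ge0 //; lra.
have y2_ge0 : 0 <= y * (y - 1) by rewrite mulr_ge0 //; lra.
(* The two sides differ by 8 times the expression in [h1], plus 8 times that in [h2], plus 4 times
   that in [h3]; [h2] needs [x + y >= 5], whence the separate case [x = 1]. *)
have h1 : 0 <= (x + y) * (y * (y - 1) + x * (x - 1)).
  by rewrite mulr_ge0 //; lra.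
have h2 : 0 <= x * y * ((x + y - 5) * (x * y + x + y - 3)).
  by rewrite mulr_ge0 // mulr_ge0 //; lra.
have h3 : 0 <= x * y * (x * y + 10 * (x + y - 3)).
  by rewrite mulr_ge0 //; lra.
rewrite /q; lra.
Qed.

Lemma w4_gt0 gamma kappa :
  (3 <= gamma)%N -> (gamma < kappa)%N -> (0 < w4 gamma kappa)%N.
Proof.
move=> hg hk; have kappa_ge4 : (4 <= kappa)%N by exact: leq_ltn_trans hg hk.
have h : (0 < 6 * 'C(gamma, 2) * 'C(kappa, 4))%N.
  by rewrite !muln_gt0 !bin_gt0 kappa_ge4 (ltnW hg).
by rewrite /w4; case: ifP => _; rewrite !addn_gt0 h.
Qed.

(** * Idempotents and interpolation between 1 and a scalar *)

Section Idempotents.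
Variables (Q : comNzRingType).
Implicit Types e s x y : Q.

Lemma idem_interpX e s n : e * e = e ->
  (e + s * (1 - e)) ^+ n.+1 = e + s ^+ n.+1 * (1 - e).
Proof.
move=> ee; elim: n => [|n IH]; first by rewrite !expr1.
rewrite exprS IH [s ^+ n.+2]exprS; set x := s ^+ n.+1.
have -> : (e + s * (1 - e)) * (e + x * (1 - e)) =
  e + s * x * (1 - e) + (e * e - e) * (1 - s - x + s * x) by ring.
by rewrite ee subrr mul0r addr0.
Qed.

(** For nested idempotents, 1 splits into [e], [e2 - e] and [1 - e2], on which the product acts as
    1, [y] and [x * y]. *)
Lemma idem_interpM e e2 x y : e2 * e = e ->
  (e2 + x * (1 - e2)) * (e + y * (1 - e)) =
  e + y * (e2 - e) + x * y * (1 - e2).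
Proof.
move=> e2e; transitivity (e + y * (e2 - e) + x * y * (1 - e2)
  + (e2 * e - e) * (1 - y - x + x * y)); first by ring.
by rewrite e2e subrr mul0r addr0.
Qed.

(** For [e] an average over powers of Y^a, this says that the image of [g] is invariant under
    multiplication by Y^a. *)
Definition absorbs (A : comNzRingType) (p : {rmorphism A -> Q}) (e g : A) :=
  p g * p e = p g.

Lemma absorbsMl (A : comNzRingType) (p : {rmorphism A -> Q}) (e g h : A) :
  absorbs p e g -> absorbs p e (g * h).
Proof. by rewrite /absorbs rmorphM mulrAC => ->. Qed.

Lemma absorbsMr (A : comNzRingType) (p : {rmorphism A -> Q}) (e g h : A) :
  absorbs p e g -> absorbs p e (h * g).
Proof. by rewrite mulrC; exact: absorbsMl. Qed.

Lemma absorbsX (A : comNzRingType) (p : {rmorphism A -> Q}) (e g : A) n :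
  absorbs p e g -> absorbs p e (g ^+ n.+1).
Proof. by rewrite exprS; exact: absorbsMl. Qed.

Lemma rmorph_absorb (A : comNzRingType) (p : {rmorphism A -> Q}) (y e c g : A) :
  p y * p e = p e -> absorbs p e g -> p (c * y * g) = p (c * g).
Proof.
move=> ye ge; rewrite !rmorphM -mulrA; congr (_ * _).
by rewrite -ge mulrCA ye.
Qed.

Lemma exp_absorb (y x : Q) n : y * x = x -> y ^+ n * x = x.
Proof.
by move=> yx; elim: n => [|n IH]; rewrite ?expr0 ?mul1r // exprS -mulrA IH.
Qed.

Lemma rmorph_interp (A : comNzRingType) (p : {rmorphism A -> Q}) (c d e g h : A) :
  d = 1 - c -> p h = p (g * e) -> p (c * g + d * h) = p (g * (e + c * (1 - e))).
Proof.
by move=> -> hE; rewrite rmorphD rmorphM [p (_ * h)]rmorphM hE -!rmorphM -rmorphD;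
  congr (p _); ring.
Qed.

Lemma interp_congr (A : comNzRingType) (p : {rmorphism A -> Q}) (g e e' c : A) :
  p e = p e' -> p (g * (e + c * (1 - e))) = p (g * (e' + c * (1 - e'))).
Proof. by move=> ee'; rewrite !(rmorphM, rmorphB, rmorphD) /= ee'. Qed.

Lemma sum2_lin (I J : finType) (c d : Q) (F G H : I -> J -> Q) :
  (forall i j, F i j = c * G i j + d * H i j) ->
  \sum_i \sum_j F i j = c * (\sum_i \sum_j G i j) + d * (\sum_i \sum_j H i j).
Proof.
move=> FE; rewrite !mulr_sumr -big_split; apply: eq_bigr => i _ /=.
by rewrite !mulr_sumr -big_split; apply: eq_bigr.
Qed.

End Idempotents.

(** Two positive semidefinite forms are paired: one has entries [a], [b], [c], the other 2/3 [w2],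
    1/2 [w3], 2/3 [w4], and the discriminant condition of the latter is the hypothesis on the
    weights. One third of the [w4] term is held back as the gain. *)
Lemma quad_form_bound (R : realFieldType) (a b c w2 w3 w4 x y z : R) :
  (forall u v, 0 <= u ^+ 2 * a + 2 * u * v * b + v ^+ 2 * c) ->
  0 <= w2 -> 0 < w4 -> 9 * w3 ^+ 2 <= 16 * w2 * w4 ->
  0 <= y -> 2 / 3 * y <= x -> y <= z ->
  w4 / 3 * y * c <= w2 * x * a + w3 * y * b + w4 * z * c.
Proof.
move=> Q w2_ge0 w4_gt0 w_le y_ge0 yx yz.
have a_ge0 : 0 <= a by move: (Q 1 0); lra.
have c_ge0 : 0 <= c by move: (Q 0 1); lra.
have w4_ge0 := ltW w4_gt0.
have hx : w2 * a * (2 / 3 * y) <= w2 * a * x by rewrite ler_wpM2l ?mulr_ge0.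
have hz : w4 * c * y <= w4 * c * z by rewrite ler_wpM2l ?mulr_ge0.
suff h : 0 <= 2 / 3 * w2 * a + w3 * b + 2 / 3 * w4 * c.
  by have := mulr_ge0 y_ge0 h; lra.
rewrite -(pmulr_rge0 _ w4_gt0).
(* 3/8 w3^2 a + w3 w4 b + 2/3 w4^2 c is a value of the quadratic form. *)
have := Q (3 / 4 * w3) w4.
have := ler_wpM2r a_ge0 w_le.
lra.
Qed.

(** * Strict descent for an abstract positive functional [t], faithful modulo the kernel of [p] *)

Section Descent.
Variables (R : realType) (A Q : comNzRingType).
Variables (p : {rmorphism A -> Q}) (star : {rmorphism A -> A}).
Variables (lc : {rmorphism R -> A}) (t : A -> R).
Hypothesis starK : involutive star.
Hypothesis star_lc : forall c, star (lc c) = lc c.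
Hypothesis tD : {morph t : g h / g + h}.
Hypothesis t_lc : forall c g, t (lc c * g) = c * t g.
Hypothesis t_proper : forall g h, p g = p h -> t g = t h.
Hypothesis t_star : forall g, t (star g) = t g.
Hypothesis t_sq_ge0 : forall g, 0 <= t (g * star g).
Hypothesis t_sq_eq0 : forall g, t (g * star g) = 0 -> p g = 0.

Lemma functional0 : t 0 = 0.
Proof. by apply: (addIr (t 0)); rewrite -tD !add0r. Qed.

Lemma functionalB : {morph t : g h / g - h}.
Proof. by move=> g h; apply/eqP; rewrite eq_sym subr_eq -tD subrK. Qed.

(* Self-adjoint idempotents modulo the kernel of p. *)
Definition projection d := (p (d * d) = p d) /\ (p (star d) = p d).

(** Cutting a square down by a self-adjoint idempotent gives a square again, so [t] is positive and
    faithful on each component. *)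
Lemma t_sqMp d g : projection d -> t (g * star g * d) = t (g * d * star (g * d)).
Proof.
move=> [dd ds]; apply: t_proper; rewrite [star (_ * _)]rmorphM.
have -> : p (g * star g * d) = p (g * star g) * p d by rewrite rmorphM.
by rewrite -dd !rmorphM /= ds; ring.
Qed.

Lemma t_sqMp_ge0 d g : projection d -> 0 <= t (g * star g * d).
Proof. by move=> /t_sqMp->; exact: t_sq_ge0. Qed.

Lemma t_sqMp_eq0 d g : projection d -> t (g * star g * d) = 0 -> p (g * d) = 0.
Proof. by move=> /t_sqMp-> /t_sq_eq0. Qed.

Section Form.
Variables (d f f2 : A).
Hypothesis proj_d : projection d.
Let fs := star f.
Let f2s := star f2.

(** This is [t] of the square of [u * f2 * fs ^+ 2 + v * f ^+ 2 * fs ^+ 2] on the component [d]; the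
    two cross terms are conjugate, so [t] agrees on them. *)
Lemma form_ge0 u v :
  0 <= u ^+ 2 * t (f2 * f2s * f ^+ 2 * fs ^+ 2 * d)
     + 2 * u * v * t (f2 * f ^+ 2 * fs ^+ 4 * d)
     + v ^+ 2 * t (f ^+ 4 * fs ^+ 4 * d).
Proof.
pose g := lc u * (f2 * fs ^+ 2) + lc v * (f ^+ 2 * fs ^+ 2).
have sg : star g = lc u * (f2s * f ^+ 2) + lc v * (fs ^+ 2 * f ^+ 2).
  by rewrite rmorphD /= !rmorphM /= !star_lc ?rmorphXn /= !starK.
have eq_cross : t (f2s * f ^+ 4 * fs ^+ 2 * d) = t (f2 * f ^+ 2 * fs ^+ 4 * d).
  rewrite -t_star; apply: t_proper; rewrite !rmorphM /= !starK (proj2 proj_d).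
  by rewrite ?rmorphXn /= ?starK; ring.
have := t_sqMp_ge0 g proj_d; congr (0 <= _); rewrite sg /g.
transitivity (t (lc (u ^+ 2) * (f2 * f2s * f ^+ 2 * fs ^+ 2 * d)
  + (lc (u * v) * (f2 * f ^+ 2 * fs ^+ 4 * d)
  + lc (u * v) * (f2s * f ^+ 4 * fs ^+ 2 * d))
  + lc (v ^+ 2) * (f ^+ 4 * fs ^+ 4 * d))).
  by congr t; rewrite ?rmorphXn ?rmorphM /=; ring.
by rewrite !tD !t_lc eq_cross; ring.
Qed.

(** Faithfulness concerns squares only, so the degree is halved step by step: [f ^+ 2 * fs ^+ 2],
    then [f * fs], then [f] vanish on the component [d]. *)
Lemma form_vertex_eq0 : t (f ^+ 4 * fs ^+ 4 * d) = 0 -> p (f * d) = 0.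
Proof.
move=> h4.
have h2 : p (f ^+ 2 * fs ^+ 2 * d) = 0.
  apply: t_sqMp_eq0 => //; rewrite -[RHS]h4; congr (t (_ * _)).
  by rewrite !rmorphM /= /fs !starK; ring.
have h1 : p (f * fs * d) = 0.
  apply: t_sqMp_eq0 => //; rewrite -[RHS]functional0; apply: t_proper; rewrite rmorph0.
  rewrite -[RHS]h2; apply: (congr1 p); rewrite [star (_ * _)]rmorphM /= /fs starK.
  by ring.
apply: t_sqMp_eq0 => //; rewrite -[RHS]functional0; apply: t_proper.
by rewrite rmorph0 -[RHS]h1.
Qed.

End Form.

Variables (w1 w2 w3 w4 : R).
Hypotheses (w1_ge0 : 0 <= w1) (w2_ge0 : 0 <= w2) (w4_gt0 : 0 < w4).
Hypothesis w_le : 9 * w3 ^+ 2 <= 16 * w2 * w4.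

(** The four arguments are independent, so that only their images under [p] have to be known. *)
Definition energy f fs f2 f2s : R :=
  w1 * t (f2 ^+ 2 * f2s ^+ 2)
  + w2 * t (f2 * f2s * f ^+ 2 * fs ^+ 2)
  + w3 * t (f2 * f ^+ 2 * fs ^+ 4)
  + w4 * t (f ^+ 4 * fs ^+ 4).

(** Think of [e] as Y = 1 and of [e2] as Y^2 = 1. The complement of [e] splits into [d1], where only
    [f] is scaled by [s], and [d2], where [f2] is scaled too. On each piece [quad_form_bound] makes
    the energy drop by at least a positive multiple of [t] of [f ^+ 4 * fs ^+ 4]. *)
Lemma energy_descent (e e2 f f2 F Fs F2 F2s : A) (s : R) :
  projection e -> projection e2 -> p (e2 * e) = p e ->
  0 <= s < 1 ->
  let u := e + lc s * (1 - e) in let u2 := e2 + lc s * (1 - e2) in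
  p F = p (f * u) -> p Fs = p (star f * u) ->
  p F2 = p (f2 * u2) -> p F2s = p (star f2 * u2) ->
  energy f (star f) f2 (star f2) <= energy F Fs F2 F2s ->
  p (f * (1 - e)) = 0.
Proof.
move=> [ee es] [e2e2 e2s] e2e /andP[s_ge0 s_lt1] u u2 pF pFs pF2 pF2s.
set fs := star f; set f2s := star f2.
pose d1 := e2 - e; pose d2 := 1 - e2.
have ee2 : p e * p e2 = p e by rewrite mulrC -rmorphM.
have pd1 : projection d1.
  split; last by rewrite /d1 !rmorphB /= es e2s.
  rewrite rmorphM /= rmorphB /= mulrBl !mulrBr -!rmorphM /= e2e2 ee e2e.
  by rewrite [e * e2]mulrC e2e; ring.
have pd2 : projection d2.
  split; last by rewrite /d2 !rmorphB /= !rmorph1 e2s.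
  by rewrite rmorphM /= rmorphB rmorph1 mulrBl !mulrBr -!rmorphM /= e2e2; ring.
have pd : projection (1 - e).
  split; last by rewrite !rmorphB /= !rmorph1 es.
  by rewrite rmorphM /= rmorphB rmorph1 mulrBl !mulrBr -!rmorphM /= ee; ring.
have uX n : p u ^+ n.+1 = p e + p (lc s) ^+ n.+1 * (1 - p e).
  rewrite /u rmorphD rmorphM /= rmorphB rmorph1 idem_interpX //.
  by rewrite -rmorphM.
have u2X n : p u2 ^+ n.+1 = p e2 + p (lc s) ^+ n.+1 * (1 - p e2).
  rewrite /u2 rmorphD rmorphM /= rmorphB rmorph1 idem_interpX //.
  by rewrite -rmorphM.
have uu2X k l : p u2 ^+ k.+1 * p u ^+ l.+1 =
   p e + p (lc s) ^+ l.+1 * (p e2 - p e) +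
   p (lc s) ^+ (k.+1 + l.+1) * (1 - p e2).
  by rewrite uX u2X idem_interpM ?exprD // -rmorphM.
have lcX n (x : R) : lc (1 - x ^+ n) = 1 - lc x ^+ n.
  by rewrite rmorphB rmorph1 rmorphXn.
(* In [E1] to [E4] the exponent of [s] counts the factors that are scaled on the component in
   question. *)
have E1 : t (f2 ^+ 2 * f2s ^+ 2) - t (F2 ^+ 2 * F2s ^+ 2) =
    (1 - s ^+ 4) * t (f2 ^+ 2 * f2s ^+ 2 * d2).
  rewrite -functionalB -t_lc; apply: t_proper.
  rewrite lcX !(rmorphM, rmorphB, rmorphXn, rmorph1) /= pF2 pF2s !rmorphM /=.
  transitivity (p f2 ^+ 2 * p f2s ^+ 2 * (1 - p u2 ^+ 4)); first by ring.
  by rewrite u2X; ring.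
have E2 : t (f2 * f2s * f ^+ 2 * fs ^+ 2) - t (F2 * F2s * F ^+ 2 * Fs ^+ 2) =
    (1 - s ^+ 4) * t (f2 * f2s * f ^+ 2 * fs ^+ 2 * d1)
    + (1 - s ^+ 6) * t (f2 * f2s * f ^+ 2 * fs ^+ 2 * d2).
  rewrite -functionalB -!t_lc -tD; apply: t_proper.
  rewrite !lcX !(rmorphM, rmorphB, rmorphD, rmorphXn, rmorph1) /=.
  rewrite pF2 pF2s pF pFs !rmorphM /=.
  transitivity (p f2 * p f2s * p f ^+ 2 * p fs ^+ 2 * (1 - p u2 ^+ 2 * p u ^+ 4)).
    by ring.
  by rewrite uu2X; ring.
have E3 : t (f2 * f ^+ 2 * fs ^+ 4) - t (F2 * F ^+ 2 * Fs ^+ 4) =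
    (1 - s ^+ 6) * t (f2 * f ^+ 2 * fs ^+ 4 * d1)
    + (1 - s ^+ 7) * t (f2 * f ^+ 2 * fs ^+ 4 * d2).
  rewrite -functionalB -!t_lc -tD; apply: t_proper.
  rewrite !lcX !(rmorphM, rmorphB, rmorphD, rmorphXn, rmorph1) /=.
  rewrite pF2 pF pFs !rmorphM /=.
  transitivity (p f2 * p f ^+ 2 * p fs ^+ 4 * (1 - p u2 ^+ 1 * p u ^+ 6)).
    by ring.
  by rewrite uu2X; ring.
have E4 : t (f ^+ 4 * fs ^+ 4) - t (F ^+ 4 * Fs ^+ 4) =
    (1 - s ^+ 8) * t (f ^+ 4 * fs ^+ 4 * d1)
    + (1 - s ^+ 8) * t (f ^+ 4 * fs ^+ 4 * d2).
  rewrite -functionalB -!t_lc -tD; apply: t_proper.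
  rewrite !lcX !(rmorphM, rmorphB, rmorphD, rmorphXn, rmorph1) /=.
  rewrite pF pFs !rmorphM /=.
  transitivity (p f ^+ 4 * p fs ^+ 4 * (1 - p u ^+ 8)); first by ring.
  by rewrite uX; ring.
have E5 : t (f ^+ 4 * fs ^+ 4 * (1 - e)) =
    t (f ^+ 4 * fs ^+ 4 * d1) + t (f ^+ 4 * fs ^+ 4 * d2).
  by rewrite -tD; congr t; rewrite /d1 /d2; ring.
have c1_ge0 : 0 <= t (f ^+ 4 * fs ^+ 4 * d1).
  by have := form_ge0 f f2 pd1 0 1; rewrite -/fs -/f2s; lra.
have c2_ge0 : 0 <= t (f ^+ 4 * fs ^+ 4 * d2).
  by have := form_ge0 f f2 pd2 0 1; rewrite -/fs -/f2s; lra.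
have c0_ge0 : 0 <= t (f2 ^+ 2 * f2s ^+ 2 * d2).
  have := t_sqMp_ge0 (f2 * f2s) pd2; congr (0 <= t _).
  by rewrite rmorphM /= /f2s starK; ring.
have sn1 n : s ^+ n <= 1 by rewrite exprn_ile1 // ltW.
have sn n : s ^+ n.+1 <= s ^+ n by rewrite exprS ler_piMl ?exprn_ge0 // ltW.
have s6_lt1 : s ^+ 6 < 1 by rewrite exprn_ilt1.
(* The constant 2/3 is the limit of the ratio of [1 - s ^+ 4] to [1 - s ^+ 6] as [s] tends to 1. *)
have s46 : 2 / 3 * (1 - s ^+ 6) <= 1 - s ^+ 4.
  suff : 0 <= 1 - 3 * s ^+ 4 + 2 * s ^+ 6 by lra.
  have -> : 1 - 3 * s ^+ 4 + 2 * s ^+ 6 =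
    (1 - s ^+ 2) ^+ 2 * (1 + 2 * s ^+ 2) by ring.
  by rewrite mulr_ge0 ?sqr_ge0 ?addr_ge0 ?mulr_ge0 ?exprn_ge0.
have s67 : 2 / 3 * (1 - s ^+ 7) <= 1 - s ^+ 6.
  suff : 0 <= 1 - 3 * s ^+ 6 + 2 * s ^+ 7 by lra.
  have -> : 1 - 3 * s ^+ 6 + 2 * s ^+ 7 =
    (1 - s) * ((1 - s ^+ 6) + s * (1 - s ^+ 5) + s ^+ 2 + s ^+ 3 + s ^+ 4 + s ^+ 5) by ring.
  apply: mulr_ge0; first by rewrite subr_ge0 ltW.
  have h5 : 0 <= s * (1 - s ^+ 5) by rewrite mulr_ge0 ?subr_ge0 ?sn1.
  have sX_ge0 n : 0 <= s ^+ n by rewrite exprn_ge0.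
  by move: (sn1 6%N) (sX_ge0 2%N) (sX_ge0 3%N) (sX_ge0 4%N) (sX_ge0 5%N); lra.
have b1 := quad_form_bound (form_ge0 f f2 pd1) w2_ge0 w4_gt0 w_le.
have := b1 (1 - s ^+ 4) (1 - s ^+ 6) (1 - s ^+ 8).
have b2 := quad_form_bound (form_ge0 f f2 pd2) w2_ge0 w4_gt0 w_le.
have := b2 (1 - s ^+ 6) (1 - s ^+ 7) (1 - s ^+ 8).
rewrite -/fs -/f2s {b1 b2}.
move=> /(_ _ s67)-/(_ ltac:(by rewrite subr_ge0)).
move=> /(_ ltac:(by rewrite lerD2l lerN2)) b2.
move=> /(_ _ s46)-/(_ ltac:(by rewrite subr_ge0)).
move=> /(_ ltac:(by rewrite lerD2l lerN2 (le_trans (sn 7%N)))) b1 le_energy.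
apply: form_vertex_eq0 => //; rewrite -/fs E5.
suff : (1 - s ^+ 6) * (t (f ^+ 4 * fs ^+ 4 * d1) + t (f ^+ 4 * fs ^+ 4 * d2)) <= 0.
  by rewrite pmulr_rle0 ?subr_gt0 // => h; apply/eqP; rewrite eq_le h addr_ge0.
have h0 : 0 <= w1 * ((1 - s ^+ 4) * t (f2 ^+ 2 * f2s ^+ 2 * d2)).
  by rewrite !mulr_ge0 ?subr_ge0.
(* This gives both components the common factor [1 - s ^+ 6]. *)
have h7 : (1 - s ^+ 6) * t (f ^+ 4 * fs ^+ 4 * d2)
    <= (1 - s ^+ 7) * t (f ^+ 4 * fs ^+ 4 * d2).
  by rewrite ler_wpM2r // lerD2l lerN2.
rewrite -(pmulr_rle0 _ w4_gt0).
have := ler_wpM2l (ltW w4_gt0) h7.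
move: le_energy; rewrite /energy -subr_ge0.
move: (congr1 (fun x => w1 * x) E1) (congr1 (fun x => w2 * x) E2).
move: (congr1 (fun x => w3 * x) E3) (congr1 (fun x => w4 * x) E4) h0 b1 b2.
lra.
Qed.

End Descent.

(** * Monomials and dilations of Laurent polynomials *)

Section Laurent.
Variable R : comNzRingType.
Implicit Types (g : laurent R) (k : int * int).

Definition mono (c : R) k : laurent R := << c *g k >>.

Lemma laurent_ind (Pr : laurent R -> Prop) :
  Pr 0 -> (forall g1 g2, Pr g1 -> Pr g2 -> Pr (g1 + g2)) ->
  (forall c k, Pr (mono c k)) -> forall g, Pr g.
Proof.
move=> Pr0 PrD PrU g; have -> : g = \sum_(k <- msupp g) mono (mcoeff k g) k.
  exact: monalgE.
by apply: big_ind.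
Qed.

Lemma mono0 k : mono 0 k = 0. Proof. exact: monalgU0. Qed.

Lemma monoD c1 c2 k : mono (c1 + c2) k = mono c1 k + mono c2 k.
Proof. exact: monalgUD. Qed.

Lemma mono1 : mono 1 0 = 1. Proof. by []. Qed.

Lemma monoM c1 c2 k1 k2 : mono c1 k1 * mono c2 k2 = mono (c1 * c2) (k1 + k2).
Proof. exact: laurent_mulUU. Qed.

Lemma mono_sum (I : Type) (r : seq I) (p : pred I) (c : I -> R) k :
  mono (\sum_(i <- r | p i) c i) k = \sum_(i <- r | p i) mono (c i) k.
Proof. by apply: (big_morph (mono^~ k)) => [a b|]; rewrite ?mono0 ?monoD. Qed.

(** An index set larger than the support lets two polynomials and their sum be expanded over the
    same set. *)
Lemma ldilateEw a (d : {fset int * int}) g : (msupp g `<=` d)%fset ->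
  ldilate a g = \sum_(k <- d) mono (mcoeff k g) (a * k.1, a * k.2).
Proof.
move=> le; rewrite /ldilate (big_fset_incl _ le) // => k _ /mcoeff_outdom ->.
exact: mono0.
Qed.

Lemma ldilateU a c k : ldilate a (mono c k) = mono c (a * k.1, a * k.2).
Proof. by rewrite (ldilateEw _ msuppU_le) big_seq_fset1 mcoeffUU. Qed.

Lemma ldilateD a : {morph @ldilate R a : g1 g2 / g1 + g2}.
Proof.
move=> g1 g2; pose d := (msupp g1 `|` msupp g2)%fset.
rewrite (@ldilateEw a d (g1 + g2)) ?msuppD_le //.
rewrite (@ldilateEw a d g1) ?fsubsetUl // (@ldilateEw a d g2) ?fsubsetUr //.
by rewrite -big_split; apply: eq_bigr => k _; rewrite mcoeffD monoD.
Qed.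

Lemma ldilate0 a : ldilate a (0 : laurent R) = 0.
Proof. by rewrite /ldilate msupp0 big_seq_fset0. Qed.

Lemma ldilate_sum a (I : Type) (r : seq I) (p : pred I) (F : I -> laurent R) :
  ldilate a (\sum_(i <- r | p i) F i) = \sum_(i <- r | p i) ldilate a (F i).
Proof. by apply: big_morph => [g1 g2|]; rewrite ?ldilateD ?ldilate0. Qed.

Lemma ldilateM a : {morph @ldilate R a : g1 g2 / g1 * g2}.
Proof.
move=> g1 g2; elim/laurent_ind: g1 => [|g h IHg IHh|c k].
- by rewrite mul0r ldilate0 mul0r.
- rewrite mulrDl; apply: etrans (ldilateD _ _ _) _.
  apply: etrans (congr2 _ IHg IHh) _; rewrite -mulrDl.
  by congr (_ * _); apply: esym; apply: ldilateD.
elim/laurent_ind: g2 => [|g h IHg IHh|c' k'].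
- by rewrite mulr0 ldilate0 mulr0.
- rewrite mulrDr; apply: etrans (ldilateD _ _ _) _.
  apply: etrans (congr2 _ IHg IHh) _; rewrite -mulrDr.
  by congr (_ * _); apply: esym; apply: ldilateD.
rewrite monoM; apply: etrans (ldilateU _ _ _) _.
apply: esym; rewrite (ldilateU a c k) (ldilateU a c' k').
by rewrite monoM; congr mono; rewrite /= !mulrDr.
Qed.

Lemma ldilate_comp a b g : ldilate a (ldilate b g) = ldilate (a * b) g.
Proof.
elim/laurent_ind: g => [|g h IHg IHh|c k]; first by rewrite !ldilate0.
  apply: etrans (congr1 _ (ldilateD _ _ _)) _; apply: etrans (ldilateD _ _ _) _.
  by apply: etrans (congr2 _ IHg IHh) _; apply: esym; apply: ldilateD.
apply: etrans (congr1 _ (ldilateU _ _ _)) _; apply: etrans (ldilateU _ _ _) _.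
by rewrite !mulrA; apply: esym; apply: ldilateU.
Qed.

Lemma ldilate1 g : ldilate 1 g = g.
Proof.
elim/laurent_ind: g => [|g h IHg IHh|c k]; first by rewrite !ldilate0.
  by rewrite !ldilateD IHg IHh.
by rewrite !ldilateU !mul1r -surjective_pairing.
Qed.

End Laurent.

(** * Class sums modulo Y^M - 1 and Parseval's identity *)

Section ClassSum.
Variables (R : realType) (M : nat).
Implicit Types (g : laurent R) (k : int * int).

(* The coefficient of X^i Y^j in the image of g in R[X^{+-1}, Y] / (Y^M - 1). *)
Definition csum g (i j : int) : R := \sum_(b \in multiples M) lcoef g i (b + j).

(** Only finitely many multiples meet the support, so the sum over an infinite set becomes a finite
    one. *)
Lemma csumEw (d : {fset int * int}) g i j : (msupp g `<=` d)%fset ->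
  csum g i j =
  \sum_(k <- d | (k.1 == i) && (M%:Z %| k.2 - j)%Z) mcoeff k g.
Proof.
move=> le; pose c := fun k => (k.1 == i) && (M%:Z %| k.2 - j)%Z.
(* The offsets b at which the coefficient at [b + j] may be nonzero; they are distinct because [k.1]
   is fixed. *)
pose r := [seq k.2 - j | k <- [seq k <- d | c k]].
rewrite /csum (@fsbigE _ _ _ _ _ r).
- rewrite /r big_map big_filter_cond /= big_mkcondr /=.
  rewrite big_mkcond [RHS]big_mkcond; apply: eq_bigr => -[x y] _ /=.
  rewrite -/(c (x, y)); case: ifP => // /andP[/= /eqP-> h].
  by rewrite subrK mem_set.
- rewrite map_inj_in_uniq ?filter_uniq ?fset_uniq// => -[x y] [x' y'].
  rewrite !mem_filter /c /= => /andP[/andP[/eqP-> _] _] /andP[/andP[/eqP-> _] _].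
  by move/addIr ->.
- by move=> b /= /mapP[k]; rewrite mem_filter => /andP[/andP[_ h] _] ->.
move=> b /= Mb bNr; apply: mcoeff_outdom; apply: contra bNr => h.
apply/mapP; exists (i, b + j); rewrite ?addrK//= mem_filter /c /= eqxx addrK Mb.
exact: (fsubsetP le).
Qed.

Lemma csumU c k i j :
  csum (mono c k) i j = if (k.1 == i) && (M%:Z %| k.2 - j)%Z then c else 0.
Proof. by rewrite (csumEw _ _ msuppU_le) big_mkcond big_seq_fset1 mcoeffUU. Qed.

Lemma csumD g1 g2 i j : csum (g1 + g2) i j = csum g1 i j + csum g2 i j.
Proof.
pose d := (msupp g1 `|` msupp g2)%fset.
rewrite (@csumEw d (g1 + g2)) ?msuppD_le //.
rewrite (@csumEw d g1) ?fsubsetUl // (@csumEw d g2) ?fsubsetUr //.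
by rewrite -big_split; apply: eq_bigr => k _; rewrite mcoeffD.
Qed.

Lemma csum0 i j : csum 0 i j = 0.
Proof. by rewrite /csum fsbig1 // => b _; rewrite /lcoef mcoeff0. Qed.

Lemma csum_sum (I : Type) (r : seq I) (p : pred I) (F : I -> laurent R) i j :
  csum (\sum_(x <- r | p x) F x) i j = \sum_(x <- r | p x) csum (F x) i j.
Proof.
by apply: (big_morph (fun g => csum g i j)) => [g1 g2|]; rewrite ?csumD ?csum0.
Qed.

Lemma csumMU c k g i j :
  csum (mono c k * g) i j = c * csum g (i - k.1) (j - k.2).
Proof.
elim/laurent_ind: g => [|g h IHg IHh|c' k'].
- by rewrite mulr0 !csum0 mulr0.
- rewrite mulrDr; apply: etrans (csumD _ _ _ _) _.
  apply: etrans (congr2 _ IHg IHh) _; rewrite -mulrDr.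
  by congr (_ * _); apply: esym; apply: csumD.
rewrite monoM !csumU /=.
have -> : (k'.1 == i - k.1) = (k.1 + k'.1 == i).
  by rewrite eq_sym subr_eq eq_sym addrC.
rewrite (_ : k.2 + k'.2 - j = k'.2 - (j - k.2)); last by ring.
by case: ifP; rewrite ?mulr0.
Qed.

Lemma csumN g i j : csum (- g) i j = - csum g i j.
Proof. by apply/eqP; rewrite -subr_eq0 opprK -csumD addNr csum0. Qed.

Lemma csumB g1 g2 i j : csum (g1 - g2) i j = csum g1 i j - csum g2 i j.
Proof. by rewrite csumD csumN. Qed.

Lemma csum_dilateN1 g i j : csum (ldilate (-1) g) i j = csum g (- i) (- j).
Proof.
elim/laurent_ind: g => [|g h IHg IHh|c k]; first by rewrite ldilate0 !csum0.
  rewrite ldilateD; apply: etrans (csumD _ _ _ _) _.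
  by apply: etrans (congr2 _ IHg IHh) _; apply: esym; apply: csumD.
rewrite ldilateU !csumU /= !mulN1r eqr_oppLR.
congr (if _ && _ then _ else _).
by rewrite [LHS]dvdzE [RHS]dvdzE -[X in (_ %| X)%N = _]abszN opprD !opprK.
Qed.

Lemma csum_mod g i j j' : (j = j' %[mod M%:Z])%Z -> csum g i j = csum g i j'.
Proof.
move=> h; rewrite !(csumEw _ _ (fsubset_refl _)); apply: eq_bigl => k.
by rewrite -!eqz_mod_dvd h.
Qed.

Definition tau g := csum g 0 0.

Lemma tauD g1 g2 : tau (g1 + g2) = tau g1 + tau g2. Proof. exact: csumD. Qed.

Lemma tau_dilateN1 g : tau (ldilate (-1) g) = tau g.
Proof. by rewrite /tau csum_dilateN1 oppr0. Qed.

Lemma tau_scale c g : tau (mono c 0 * g) = c * tau g.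
Proof. by rewrite /tau csumMU !subr0. Qed.

(* Parseval; the pairs in D represent the residue classes met by g. *)
Lemma tau_sq g : exists2 D : seq (int * int),
  tau (g * ldilate (-1) g) = \sum_(k <- D) csum g k.1 k.2 ^+ 2 &
  forall i j, csum g i j != 0 -> (i, (j %% M%:Z)%Z) \in D.
Proof.
pose rep k := (k.1, (k.2 %% M%:Z)%Z).
exists [fset rep k | k in msupp g]%fset.
  have -> : tau (g * ldilate (-1) g) =
            \sum_(k <- msupp g) mcoeff k g * csum g k.1 k.2.
    rewrite {1}(monalgE g) mulr_suml /tau csum_sum; apply: eq_bigr => k _.
    by rewrite (csumMU (mcoeff k g)) !sub0r csum_dilateN1 !opprK.
  (* Within a residue class the coefficients add up to one factor [csum], and the other factor is
     constant. *)
  rewrite (partition_big_imfset _ rep) /=; apply: eq_big_seq => r.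
  move=> /imfsetP[k0 /= _ ->]; rewrite expr2 {1}(csumEw _ _ (fsubset_refl _)) /=.
  rewrite mulr_suml; apply: eq_big => k.
    by rewrite xpair_eqE -eqz_mod_dvd modz_mod.
  rewrite xpair_eqE => /andP[/eqP-> /eqP h]; congr (_ * _).
  by apply: csum_mod; rewrite modz_mod.
move=> i j; apply: contraNT => h; apply/eqP.
rewrite (csumEw _ _ (fsubset_refl _)) big_seq_cond big1 // => k.
move=> /and3P[kg /eqP ki]; rewrite -eqz_mod_dvd => /eqP kj.
by case/negP: h; apply/imfsetP; exists k => //; rewrite /rep ki kj.
Qed.

Lemma tau_sq_ge0 g : 0 <= tau (g * ldilate (-1) g).
Proof. by have [D -> _] := tau_sq g; apply: sumr_ge0 => k _; exact: sqr_ge0. Qed.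

Lemma tau_sq_eq0 g i j : tau (g * ldilate (-1) g) = 0 -> csum g i j = 0.
Proof.
have [D -> h] := tau_sq g; move=> /eqP; rewrite psumr_eq0; last first.
  by move=> k _; exact: sqr_ge0.
move=> /allP D0; apply/eqP; apply/negPn/negP => hij.
have /= := D0 _ (h _ _ hij).
by rewrite (@csum_mod g i _ j) ?modz_mod // sqrf_eq0 (negPf hij).
Qed.

End ClassSum.

(** * Dilations and constants as ring morphisms *)

Section LaurentMorphisms.
Variable R : comNzRingType.

Lemma ldilate_is_zmod_morphism a : zmod_morphism (@ldilate R a).
Proof.
move=> g h; have E : ldilate a (g - h) + ldilate a h = ldilate a g.
  by apply: etrans (esym (ldilateD _ _ _)) _; rewrite subrK.
by apply/eqP; rewrite eq_sym subr_eq; apply/eqP; rewrite E.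
Qed.

Lemma ldilate_is_monoid_morphism a : monoid_morphism (@ldilate R a).
Proof.
split; last exact: ldilateM.
by apply: etrans (ldilateU _ _ _) _; rewrite !mulr0.
Qed.

HB.instance Definition _ a := GRing.isZmodMorphism.Build
  (laurent R) (laurent R) (@ldilate R a) (ldilate_is_zmod_morphism a).
HB.instance Definition _ a := GRing.isMonoidMorphism.Build
  (laurent R) (laurent R) (@ldilate R a) (ldilate_is_monoid_morphism a).

Definition lconst (c : R) : laurent R := mono c 0.

Lemma lconst_is_zmod_morphism : zmod_morphism lconst.
Proof.
move=> c d; apply: etrans (monoD _ _ _) _; congr (_ + _).
exact: monalgUN.
Qed.

Lemma lconst_is_monoid_morphism : monoid_morphism lconst.
Proof. by split=> // c d; apply: esym; apply: etrans (monoM _ _ _ _) _; rewrite addr0. Qed.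

HB.instance Definition _ := GRing.isZmodMorphism.Build
  R (laurent R) lconst lconst_is_zmod_morphism.
HB.instance Definition _ := GRing.isMonoidMorphism.Build
  R (laurent R) lconst lconst_is_monoid_morphism.

Lemma ldilate_lconst a c : ldilate a (lconst c) = lconst c.
Proof. by apply: etrans (ldilateU _ _ _) _; rewrite !mulr0. Qed.

Lemma lcoefMU (c : R) k (g : laurent R) i j :
  lcoef (mono c k * g) i j = c * lcoef g (i - k.1) (j - k.2).
Proof.
elim/laurent_ind: g => [|g h IHg IHh|c' k'].
- by rewrite mulr0 /lcoef !mcoeff0 mulr0.
- rewrite mulrDr; apply: etrans (mcoeffD _ _ _) _.
  apply: etrans (congr2 _ IHg IHh) _; rewrite -mulrDr.
  by congr (_ * _); apply: esym; apply: mcoeffD.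
rewrite monoM /lcoef.
apply: etrans (mcoeffU _ _ _) _; apply: esym.
apply: etrans (congr1 _ (mcoeffU _ _ _)) _; rewrite mulrnAr.
case: k k' => [a b] [a' b'] /=; rewrite !xpair_eqE /=.
have E x y z : (x == y - z :> int) = (z + x == y).
  by rewrite eq_sym subr_eq eq_sym addrC.
by rewrite !E.
Qed.

End LaurentMorphisms.

(** * The quotient by Y^M - 1 *)

Section Quotient.
Variables (R : realType) (M : nat).
Local Notation L := (laurent R).

(** The ideal generated by Y^M - 1, described so that equality in the quotient is tested on class
    sums. *)
Definition null_classes : {pred L} :=
  fun g => `[< forall i j, csum M g i j = 0 >].

Lemma null_classesP g :
  reflect (forall i j, csum M g i j = 0) (g \in null_classes).
Proof. exact: asboolP. Qed.

(** A monomial factor only shifts and scales class sums, and monomials span. *)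
Lemma null_classes_idealr : idealr_closed null_classes.
Proof.
split.
- by apply/null_classesP => i j; exact: csum0.
- apply/negP => /null_classesP /(_ 0 0) /eqP.
  by rewrite -mono1 csumU eqxx subr0 dvdz0 oner_eq0.
move=> a g h /null_classesP Ig /null_classesP Ih; apply/null_classesP => i j.
apply: etrans (csumD _ _ _ _ _) _; rewrite Ih addr0.
elim/laurent_ind: a => [|a b IHa IHb|c k]; first by rewrite mul0r csum0.
  rewrite mulrDl; apply: etrans (csumD _ _ _ _ _) _.
  by apply: etrans (congr2 _ IHa IHb) _; rewrite addr0.
by apply: etrans (csumMU _ _ _ _ _ _) _; rewrite Ig mulr0.
Qed.

HB.instance Definition _ := isIdealr.Build L null_classes null_classes_idealr.

(* R[X^{+-1}, Y] / (Y^M - 1) *)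
Definition cyc_laurent : comNzRingType := {ideal_quot null_classes}.

Definition cyc (g : L) : cyc_laurent := \pi_cyc_laurent%qT g.

Lemma cyc_is_zmod_morphism : zmod_morphism cyc.
Proof. exact: raddfB. Qed.

Lemma cyc_is_monoid_morphism : monoid_morphism cyc.
Proof. by split=> [|g h]; [exact: rmorph1|exact: rmorphM]. Qed.

HB.instance Definition _ := GRing.isZmodMorphism.Build
  L cyc_laurent cyc cyc_is_zmod_morphism.
HB.instance Definition _ := GRing.isMonoidMorphism.Build
  L cyc_laurent cyc cyc_is_monoid_morphism.

Lemma cycP g h :
  cyc g = cyc h <-> forall i j, csum M g i j = csum M h i j.
Proof.
have E : (cyc g == cyc h) = (g - h \in null_classes).
  by rewrite Quotient.idealrBE.
split=> [/eqP|gh]; last first.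
  apply/eqP; rewrite E; apply/null_classesP => i j.
  by rewrite csumB gh subrr.
rewrite E => /null_classesP h0 i j; apply/eqP.
by rewrite -subr_eq0 -csumB h0.
Qed.

End Quotient.

(** * Averages over powers of Y as idempotents *)

Section Averaging.
Variables (R : realType) (M : nat).
Hypothesis M_gt0 : (0 < M)%N.
Local Notation cyc := (@cyc R M).
Local Notation L := (laurent R).

Lemma cyc_mono_mod (c : R) (i j j' : int) : (j = j' %[mod M%:Z])%Z ->
  cyc (mono c (i, j)) = cyc (mono c (i, j')).
Proof.
by move=> h; apply/cycP => x y; rewrite !csumU /= -!eqz_mod_dvd h.
Qed.

(* Modulo Y^M - 1 this is the idempotent that projects onto Y^a = 1. *)
Definition avg (a : int) : L := \sum_(j < M) mono M%:R^-1 (0, a * j%:Z).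

Lemma ldilateN1_avg a : ldilate (-1) (avg a) = avg (- a).
Proof.
rewrite /avg ldilate_sum; apply: eq_bigr => j _.
by apply: etrans (ldilateU _ _ _) _; rewrite mulr0 mulN1r mulNr.
Qed.

Lemma monoMpair (c c' : R) (i j i' j' : int) :
  mono c (i, j) * mono c' (i', j') = mono (c * c') (i + i', j + j').
Proof. exact: monoM. Qed.

(** Multiplication by Y^a moves each term of the average to the next, and the last to the first
    because Y^(aM) = 1. *)
Lemma cyc_Y_avg a : cyc (mono 1 (0, a)) * cyc (avg a) = cyc (avg a).
Proof.
pose F n := cyc (mono M%:R^-1 (0, a * n%:Z)).
have FM : F M = F 0.
  by apply: cyc_mono_mod; rewrite mulr0 modzMl mod0z.
rewrite -rmorphM /avg mulr_sumr !rmorph_sum /=.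
transitivity (\sum_(j < M) F j.+1).
  apply: eq_bigr => j _; rewrite /F monoMpair mul1r addr0.
  by rewrite -[j.+1]add1n PoszD mulrDr mulr1.
rewrite -[LHS](big_mkord xpredT (fun j => F j.+1)).
rewrite -[RHS](big_mkord xpredT F); apply: (addrI (F 0)).
by rewrite -big_nat_recl // big_nat_recr //= addrC FM.
Qed.

Lemma monoYX a n : mono 1 (0, a * n%:Z) = mono 1 (0, a) ^+ n :> L.
Proof.
elim: n => [|n IH]; first by rewrite mulr0.
by rewrite exprS -IH monoMpair mulr1 addr0 -[n.+1]add1n PoszD mulrDr mulr1.
Qed.

(** If Y^a fixes [x], the product is the mean of [M] copies of [x]. *)
Lemma cyc_avg_absorb a x : cyc (mono 1 (0, a)) * x = x -> cyc (avg a) * x = x.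
Proof.
move=> Yx; have YXx n : cyc (mono 1 (0, a * n%:Z)) * x = x.
  by rewrite monoYX rmorphXn exp_absorb.
rewrite /avg rmorph_sum mulr_suml /=.
transitivity (\sum_(j < M) cyc (lconst M%:R^-1) * x).
  apply: eq_bigr => j _; rewrite -[in RHS](YXx j) mulrA -rmorphM.
  by congr (cyc _ * _); rewrite monoM mulr1 add0r.
rewrite -mulr_suml sumr_const card_ord -!rmorphMn /= -mulr_natr mulVf ?rmorph1 ?mul1r //.
by rewrite pnatr_eq0 -lt0n.
Qed.

(** Each of the two averages absorbs the other, so commutativity identifies them. This makes [avg a]
    self-adjoint. *)
Lemma cyc_avgN a : cyc (avg (- a)) = cyc (avg a).
Proof.
have absorb b : cyc (avg (- b)) * cyc (avg b) = cyc (avg b).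
  apply: cyc_avg_absorb; rewrite -{1}(cyc_Y_avg b) mulrA -rmorphM monoMpair mulr1 addr0 addNr.
  by rewrite -[mono _ _]/(1 : L) rmorph1 mul1r.
by rewrite -(absorb (- a)) opprK mulrC absorb.
Qed.

Lemma cyc_YX_avg a (k : int) : cyc (mono 1 (0, a * k)) * cyc (avg a) = cyc (avg a).
Proof.
have pos b n : cyc (mono 1 (0, b * n%:Z)) * cyc (avg b) = cyc (avg b).
  by rewrite monoYX rmorphXn; exact: exp_absorb (cyc_Y_avg b).
case: k => n; first exact: pos.
by rewrite NegzE mulrN -mulNr -cyc_avgN pos.
Qed.

Lemma projection_avg a : projection cyc (@ldilate R (-1)) (avg a).
Proof.
split; last by rewrite -[LHS]/(cyc (ldilate _ _)) ldilateN1_avg cyc_avgN.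
by rewrite rmorphM; apply: cyc_avg_absorb; exact: cyc_Y_avg.
Qed.

(** Y = 1 implies Y^2 = 1, so the two idempotents are nested. *)
Lemma cyc_avg2_avg1 : cyc (avg 2 * avg 1) = cyc (avg 1).
Proof.
by rewrite rmorphM; apply: cyc_avg_absorb; have := cyc_YX_avg 1 2; rewrite mul1r.
Qed.

(** Powers of Y^a act trivially on what [avg a] absorbs; this is how the dependence on j leaves the
    gradient. *)
Lemma cyc_shift a (c : R) (i k : int) g : absorbs cyc (avg a) g ->
  cyc (mono c (i, a * k) * g) = cyc (mono c (i, 0) * g).
Proof.
have -> : mono c (i, a * k) = mono c (i, 0) * mono 1 (0, a * k) :> L.
  by rewrite monoMpair mulr1 addr0 add0r.
exact: rmorph_absorb (cyc_YX_avg a k).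
Qed.

End Averaging.

(** * The polynomial of a matrix and its row means *)

Section Polynomials.
Variables (R : realType) (m M : nat).
Hypothesis M_gt0 : (0 < M)%N.
Local Notation cyc := (@cyc R M).
Local Notation avg := (avg R M).
Implicit Types P : 'M[R]_(m, M).

Definition row_mean P : 'M[R]_(m, M) :=
  \matrix_(i, j) (M%:R^-1 * \sum_(j' < M) P i j').

Lemma ldilate_lpoly a P : ldilate a (lpoly P) =
  \sum_(i < m) \sum_(j < M) mono (P i j) (a * i%:Z, a * j%:Z).
Proof.
rewrite /lpoly ldilate_sum; apply: eq_bigr => i _.
by rewrite ldilate_sum; apply: eq_bigr => j _; exact: ldilateU.
Qed.

(** Where Y^a = 1 every Y^(aj) counts as 1, so only the row sums of [P] survive, and [avg a] spreads
    them evenly. *)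
Lemma cyc_lpoly_avg a P :
  cyc (ldilate a (lpoly P) * avg a) = cyc (ldilate a (lpoly (row_mean P))).
Proof.
apply: etrans (congr1 (fun g => cyc (g * _)) (ldilate_lpoly a P)) _.
apply: esym; apply: etrans (congr1 cyc (ldilate_lpoly a _)) _; apply: esym.
rewrite mulr_suml !rmorph_sum; apply: eq_bigr => i _ /=.
rewrite mulr_suml rmorph_sum.
transitivity (\sum_(j < M) cyc (mono (P i j) (a * i%:Z, 0) * avg a)).
  apply: eq_bigr => j _ /=; apply: cyc_shift => //.
  by rewrite /absorbs -[LHS]rmorphM; exact: (proj1 (projection_avg _ _ _)).
rewrite -rmorph_sum -mulr_suml -mono_sum /avg mulr_sumr.
congr (cyc _); apply: eq_bigr => j _ /=.
by rewrite monoMpair mxE mulrC addr0 add0r.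
Qed.

Lemma ldilate_lpoly_lin a s t P P' : ldilate a (lpoly (s *: P + t *: P')) =
  lconst s * ldilate a (lpoly P) + lconst t * ldilate a (lpoly P').
Proof.
apply: etrans (ldilate_lpoly _ _) _; apply: esym.
apply: etrans (congr2 (fun g h => lconst s * g + lconst t * h)
  (ldilate_lpoly a P) (ldilate_lpoly a P')) _.
apply: esym; apply: sum2_lin => i j; rewrite !mxE.
apply: etrans (monoD _ _ _) _; congr (_ + _).
  by apply: esym; apply: etrans (monoM _ _ _ _) _; rewrite add0r.
by apply: esym; apply: etrans (monoM _ _ _ _) _; rewrite add0r.
Qed.

(** One move towards the row means yields the interpolating factors of [energy_descent] for all
    dilations at once. *)
Lemma cyc_lpoly_interp a s P :
  cyc (ldilate a (lpoly (s *: P + (1 - s) *: row_mean P))) =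
  cyc (ldilate a (lpoly P) * (avg a + lconst s * (1 - avg a))).
Proof.
apply: etrans (congr1 cyc (ldilate_lpoly_lin _ _ _ _ _)) _.
apply: rmorph_interp; first by rewrite [LHS]rmorphB rmorph1.
exact: esym (cyc_lpoly_avg a P).
Qed.

(** The exponents of Y are below [M], hence distinct modulo [M], and the quotient loses no entry of
    the matrix. *)
Lemma csum_lpoly P (i : 'I_m) (j : 'I_M) : csum M (lpoly P) i j = P i j.
Proof.
rewrite /lpoly csum_sum (bigD1 i) //= csum_sum (bigD1 j) //=.
rewrite csumU /= eqxx subrr dvdz0 /= !big1 ?addr0 // => [i' ii'|j' jj'].
  by rewrite csum_sum big1 // => j' _; rewrite csumU /= eqz_nat val_eqE (negPf ii').
rewrite csumU /= eqxx -eqz_mod_dvd !modz_small ?ltz_nat ?ltn_ord //=.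
by rewrite eqz_nat val_eqE (negPf jj').
Qed.

Lemma eq_row_mean P : cyc (lpoly P * (1 - avg 1)) = 0 -> P = row_mean P.
Proof.
rewrite mulrBr mulr1 rmorphB => /eqP; rewrite subr_eq0 => /eqP h.
have := cyc_lpoly_avg 1 P; rewrite !ldilate1 -h => /cycP e.
by apply/matrixP => i j; rewrite -csum_lpoly e csum_lpoly.
Qed.

Lemma absorbs_row_mean a P : P = row_mean P ->
  absorbs cyc (avg a) (ldilate a (lpoly P)).
Proof.
move=> eP; apply: etrans (esym (rmorphM _ _ _)) (etrans (cyc_lpoly_avg a P) _).
by rewrite -eP.
Qed.

End Polynomials.

(** * [N8] as an energy, and rigidity of its local minimizers *)

Section Energy.
Variables (R : realType) (M : nat).
Hypothesis M_gt0 : (0 < M)%N.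
Local Notation cyc := (@cyc R M).
Local Notation avg := (avg R M).
Local Notation tau := (@tau R M).
Local Notation star := (@ldilate R (-1)).

Lemma tau_proper g h : cyc g = cyc h -> tau g = tau h.
Proof. by move=> /cycP; apply. Qed.

Lemma tau_sq_cyc0 g : tau (g * star g) = 0 -> cyc g = 0.
Proof.
move=> h; rewrite -[RHS](rmorph0 cyc); apply/cycP => i j.
by rewrite csum0; exact: tau_sq_eq0.
Qed.

Lemma ldilateN1K : involutive star.
Proof. by move=> g; rewrite ldilate_comp mulN1r opprK ldilate1. Qed.

Lemma ldilateN1_2 g : star (ldilate 2 g) = ldilate (- 2) g.
Proof. by rewrite ldilate_comp mulN1r. Qed.

Lemma fsum_lcoef g (F : int -> R) :
  (forall b, F b = lcoef g 0 b) -> \sum_(b \in multiples M) F b = tau g.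
Proof. by move=> FE; apply: eq_fsbigr => b _; rewrite FE addr0. Qed.

Lemma lcoef_scale (c : R) (g : laurent R) i j :
  c * lcoef g i j = lcoef (lconst c * g) i j.
Proof. by apply: esym; apply: etrans (lcoefMU _ _ _ _ _) _; rewrite !subr0. Qed.

Lemma lcoef_shift (c : R) (g : laurent R) i j b :
  c * lcoef g i (b + j) = lcoef (mono c (- i, - j) * g) 0 b.
Proof.
by apply: esym; apply: etrans (lcoefMU _ _ _ _ _) _; rewrite !opprK add0r.
Qed.

Lemma lcoefD (g h : laurent R) i j :
  lcoef g i j + lcoef h i j = lcoef (g + h) i j.
Proof. by apply: esym; exact: mcoeffD. Qed.

Lemma N8_energy gamma kappa m (P : 'M[R]_(m.+1, M)) : let f := lpoly P in
  N8 gamma kappa P =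
  energy tau (w1 gamma kappa)%:R (w2 gamma kappa)%:R (w3 gamma kappa)%:R
    (w4 gamma kappa)%:R f (star f) (ldilate 2 f) (star (ldilate 2 f)).
Proof.
move=> f; rewrite ldilateN1_2 /N8 /energy -/f -!tau_scale -!tauD.
by apply: fsum_lcoef => b; rewrite !lcoef_scale !lcoefD.
Qed.

(** Row means stay in [0, 1] and keep the row sums, so convexity applies; the displacement is
    [1 - s] times a difference of two numbers in [0, 1]. *)
Lemma feasible_interp m (pstar : 'I_m.+1 -> R) (P : 'M[R]_(m.+1, M)) s :
  0 <= s <= 1 -> feasible pstar P ->
  feasible pstar (s *: P + (1 - s) *: row_mean P) /\
  forall i j, `|P i j - (s *: P + (1 - s) *: row_mean P) i j| <= 1 - s.
Proof.
move=> /andP[s0 s1] [P01 Prow].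
have M0 : M%:R != 0 :> R by rewrite pnatr_eq0 -lt0n.
have MV : 0 < M%:R^-1 :> R by rewrite invr_gt0 ltr0n.
have U01 i j : 0 <= row_mean P i j <= 1.
  rewrite mxE mulr_ge0 ?(ltW MV) ?sumr_ge0 //=; last first.
    by move=> j' _; case/andP: (P01 i j').
  rewrite ler_pdivrMl ?ltr0n // mulr1 -[in leRHS](card_ord M) -sum1_card natr_sum.
  by apply: ler_sum => j' _; case/andP: (P01 i j').
split; last first.
  move=> i j; rewrite !mxE -/(row_mean P i j); set u := _^-1 * _.
  have -> : P i j - (s * P i j + (1 - s) * u) = (1 - s) * (P i j - u) by ring.
  have := U01 i j; rewrite mxE -/u => /andP[u0 u1]; have /andP[p0 p1] := P01 i j.
  by rewrite normrM ger0_norm ?subr_ge0 // ler_piMr ?subr_ge0 // ler_norml; lra.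
have SE i j : (s *: P + (1 - s) *: row_mean P) i j =
    s * P i j + (1 - s) * row_mean P i j by rewrite !mxE.
split=> [i j|i].
  have /andP[u0 u1] := U01 i j; have /andP[p0 p1] := P01 i j.
  have s0' : 0 <= 1 - s by lra.
  have := (mulr_ge0 s0 p0, mulr_ge0 s0' u0).
  have := (ler_wpM2l s0 p1, ler_wpM2l s0' u1).
  by rewrite SE => -[? ?] [? ?]; lra.
under eq_bigr do rewrite SE [row_mean _ _ _]mxE.
rewrite big_split /= -!mulr_sumr sumr_const card_ord Prow.
by rewrite -[pstar i *+ M]mulr_natl mulKf //; ring.
Qed.

Lemma local_min_eq_row_mean gamma kappa m (pstar : 'I_m.+1 -> R)
    (P : 'M[R]_(m.+1, M)) :
  (3 <= gamma)%N -> (gamma < kappa)%N ->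
  local_min_on (feasible pstar) (@N8 R gamma kappa m M) P -> P = row_mean P.
Proof.
move=> hg hk [Pfeas /nbhs_ballP[eps /= eps_gt0 minP]].
(* [1 - s] stays below the radius of the ball, and 1/2 keeps [s] nonnegative. *)
pose s := 1 - Num.min (1 / 2) (eps / 2).
have [s_ge0 s_lt1 s_eps] : [/\ 0 <= s, s < 1 & 1 - s < eps].
  by rewrite /s; case: (leP (1 / 2) (eps / 2)) => ?; split; lra.
have [|Sfeas dist] := @feasible_interp _ _ P s _ Pfeas.
  by rewrite s_ge0 ltW.
have := minP (s *: P + (1 - s) *: row_mean P) _ Sfeas; move=> /(_ _)/wrap[].
  by split=> // i j; apply: le_lt_trans (dist i j) s_eps.
rewrite !N8_energy => le_energy; apply: eq_row_mean => //.
have w4_pos : 0 < (w4 gamma kappa)%:R :> R by rewrite ltr0n w4_gt0.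
have descent := @energy_descent R (laurent R) (cyc_laurent R M) cyc star
  (@lconst R) tau ldilateN1K (ldilate_lconst _) (@tauD R M) (@tau_scale R M)
  tau_proper (@tau_dilateN1 R M) (@tau_sq_ge0 R M) tau_sq_cyc0 _ _ _ _
  (ler0n _ _) (ler0n _ _) w4_pos (weights_le _ hg hk) (avg 1) (avg 2).
have interp a := cyc_lpoly_interp M_gt0 a s P.
have s01 : 0 <= s < 1 by rewrite s_ge0.
have e12 := cyc_avg2_avg1 R M_gt0.
have pe a := projection_avg R M_gt0 a.
have D := descent _ _ _ _ _ _ _ _ (pe 1) (pe 2) e12 s01 _ _ _ _ le_energy.
apply: D.
- apply: etrans (congr1 cyc (esym (ldilate1 _))) _.
  apply: etrans (interp 1) _.
  by apply: (congr1 cyc); congr (_ * _); exact: ldilate1.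
(* Dilation by -1 produces [avg (- 1)], which agrees with [avg 1] in the quotient. *)
- apply: etrans (interp (-1)) _; apply: interp_congr.
  exact: cyc_avgN.
- exact: interp.
- apply: etrans (congr1 cyc (ldilateN1_2 _)) _.
  apply: etrans (interp (- 2)) _.
  apply: etrans (interp_congr _ _ (cyc_avgN R M_gt0 2)) _.
  by rewrite /= ldilateN1_2.
Qed.

(** Summands that are coefficients of one Laurent polynomial have finite support, so these sums over
    all multiples can be added freely. *)
Definition sums_to (F : int -> R) (r : R) : Prop :=
  exists2 g, forall b, F b = lcoef g 0 b & tau g = r.

Lemma sums_toP F r : sums_to F r -> \sum_(b \in multiples M) F b = r.
Proof. by move=> [g Fg <-]; exact: fsum_lcoef. Qed.

Lemma sums_toD F F' r r' :
  sums_to F r -> sums_to F' r' -> sums_to (fun b => F b + F' b) (r + r').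
Proof.
move=> [g Fg gr] [g' Fg' gr']; exists (g + g') => [b|].
  by rewrite Fg Fg' lcoefD.
by apply: etrans (tauD _ _ _) _; rewrite gr gr'.
Qed.

Lemma sums_to_shift a (c : R) (i k : int) g : absorbs cyc (avg a) g ->
  sums_to (fun b => c * lcoef g i (b + a * k)) (tau (mono c (- i, 0) * g)).
Proof.
move=> ag; exists (mono c (- i, - (a * k)) * g) => [b|].
  exact: lcoef_shift.
by apply: tau_proper; rewrite -mulrN; exact: cyc_shift.
Qed.

Lemma sums_to_shift1 (c : R) (i k : int) g : absorbs cyc (avg 1) g ->
  sums_to (fun b => c * lcoef g i (b + k)) (tau (mono c (- i, 0) * g)).
Proof. by move=> /(sums_to_shift c i k); rewrite mul1r. Qed.

End Energy.

Theorem lemma2 (R : realType) (gamma kappa m M : nat)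
    (hgamma : (3 <= gamma)%N) (hkappa : (gamma < kappa)%N)
    (hm : (1 <= m)%N) (hM : (2 <= M)%N)
    (pstar : 'I_m.+1 -> R)
    (pstar_ge0 : forall i, 0 <= pstar i)
    (pstar_sum : \sum_(i < m.+1) pstar i = 1)
    (P : 'M[R]_(m.+1, M))
    (hP : local_min_on (feasible pstar) (@N8 R gamma kappa m M) P) :
  exists c : 'I_m.+1 -> R, forall (i : 'I_m.+1) (j : 'I_M),
    let f := lpoly P in
    \sum_(b \in multiples M)
      ((w1 gamma kappa)%:R
         * lcoef (4 * ldilate 2 f ^+ 2 * ldilate (-2) f)
             (2 * i%:Z) (b + 2 * j%:Z)
     + (w2 gamma kappa)%:R
         * lcoef (2 * ldilate 2 f * f ^+ 2 * ldilate (-1) f ^+ 2)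
             (2 * i%:Z) (b + 2 * j%:Z)
     + (w2 gamma kappa)%:R
         * lcoef (4 * ldilate 2 f * ldilate (-2) f * f ^+ 2 * ldilate (-1) f)
             i%:Z (b + j%:Z)
     + (w3 gamma kappa)%:R
         * lcoef (f ^+ 2 * ldilate (-1) f ^+ 4)
             (- (2 * i%:Z)) (b - 2 * j%:Z)
     + (w3 gamma kappa)%:R
         * lcoef (2 * ldilate 2 f * f * ldilate (-1) f ^+ 4)
             (- i%:Z) (b - j%:Z)
     + (w3 gamma kappa)%:R
         * lcoef (4 * ldilate 2 f * f ^+ 2 * ldilate (-1) f ^+ 3)
             i%:Z (b + j%:Z)
     + (w4 gamma kappa)%:R
         * lcoef (8 * f ^+ 4 * ldilate (-1) f ^+ 3)
             i%:Z (b + j%:Z))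
    = c i.
Proof.
have M_gt0 : (0 < M)%N := ltnW hM.
(* Constant rows make averages absorb [f] and its dilation by 2, and this alone makes the gradient
   constant along each row. *)
have eqP := local_min_eq_row_mean M_gt0 hgamma hkappa hP.
pose f := lpoly P.
have f2_abs : absorbs (@cyc R M) (avg R M 2) (ldilate 2 f).
  exact: absorbs_row_mean.
have f_abs : absorbs (@cyc R M) (avg R M 1) f.
  by have := absorbs_row_mean M_gt0 1 eqP; rewrite ldilate1.
(* The witness is the value of the left-hand side at j = 0. *)
exists (fun i : 'I_m.+1 =>
    tau M (mono (w1 gamma kappa)%:R (- (2 * i%:Z), 0) *
      (4 * ldilate 2 f ^+ 2 * ldilate (-2) f))
  + tau M (mono (w2 gamma kappa)%:R (- (2 * i%:Z), 0) *
      (2 * ldilate 2 f * f ^+ 2 * ldilate (-1) f ^+ 2))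
  + tau M (mono (w2 gamma kappa)%:R (- i%:Z, 0) *
      (4 * ldilate 2 f * ldilate (-2) f * f ^+ 2 * ldilate (-1) f))
  + tau M (mono (w3 gamma kappa)%:R (- - (2 * i%:Z), 0) *
      (f ^+ 2 * ldilate (-1) f ^+ 4))
  + tau M (mono (w3 gamma kappa)%:R (- - i%:Z, 0) *
      (2 * ldilate 2 f * f * ldilate (-1) f ^+ 4))
  + tau M (mono (w3 gamma kappa)%:R (- i%:Z, 0) *
      (4 * ldilate 2 f * f ^+ 2 * ldilate (-1) f ^+ 3))
  + tau M (mono (w4 gamma kappa)%:R (- i%:Z, 0) *
      (8 * f ^+ 4 * ldilate (-1) f ^+ 3))) => i j.
apply: sums_toP; do 6?[apply: sums_toD].
(* Only dilations by 2 and -2 occur in this term; [avg 2] suffices because the shift is 2j. *)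
- apply: (sums_to_shift M_gt0).
  by apply: absorbsMl; apply: absorbsMr; apply: absorbsX.
(* All remaining terms contain a factor [f], so [avg 1] absorbs them and any shift is allowed. *)
- apply: (sums_to_shift1 M_gt0).
  by apply: absorbsMl; apply: absorbsMr; apply: absorbsX.
- apply: (sums_to_shift1 M_gt0).
  by apply: absorbsMl; apply: absorbsMr; apply: absorbsX.
- apply: (sums_to_shift1 M_gt0).
  by apply: absorbsMl; apply: absorbsX.
- apply: (sums_to_shift1 M_gt0).
  by apply: absorbsMl; apply: absorbsMr.
- apply: (sums_to_shift1 M_gt0).
  by apply: absorbsMl; apply: absorbsMr; apply: absorbsX.
- apply: (sums_to_shift1 M_gt0).
  by apply: absorbsMl; apply: absorbsMr; apply: absorbsX.
Qed.
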